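(* Let $\mathbf{V},P$ be two Hilbert spaces, let $A:\mathbf{V}\to\mathbf{V}^{*}$ and $B:\mathbf{V}\to P$ be linear operators, with $B^{*}:P\to\mathbf{V}^{*}$ the adjoint of $B$, and let $f\in\mathbf{V}^{*}$. Assume that $A$ is invertible and that the Schur complement operator $\mathcal{A}:=BA^{-1}B^{*}:P\to P$ is an invertible, self-adjoint, bounded, positive definite operator, and let $m,M$ be positive constants such that $$0<m|q|^{2}\le(\mathcal{A}q,q)\le M|q|^{2}\quad\text{for all }0\ne q\in P .$$ Consider the Ramshaw–Mesina iteration with real parameters $\alpha,\beta$: given $u^{n},p^{n}$, find $u^{n+1},p^{n+1}$ from $$Au^{n+1}+B^{*}p^{n}=f,\qquad p^{n+1}-p^{n}-\beta B(u^{n+1}-u^{n})-\alpha^{2}Bu^{n+1}=0 .$$ This iteration converges if $\beta\ge 0$ and $$\beta+\alpha^{2}<\frac{1}{M}.$$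
   Context: $\mathbf{V}^{*}$ is the dual space of $\mathbf{V}$; $(\cdot,\cdot)$ and $|\cdot|$ denote the inner product and norm of $P$. The adjoint $B^{*}$ is defined by $\langle B^{*}q,v\rangle=(q,Bv)$ for all $q\in P$, $v\in\mathbf{V}$, where $\langle\cdot,\cdot\rangle$ is the duality pairing between $\mathbf{V}^{*}$ and $\mathbf{V}$. The iteration is the abstract form of the following one for the Stokes problem in a domain $\Omega$, obtained with $A=-\triangle$, $B^{*}=\nabla$, $B=-\nabla\cdot$, $\mathbf{V}=(H_0^1(\Omega))^{d}$, $P=L_0^2(\Omega)$ (square-integrable functions of mean zero) and $f\in\mathbf{V}^{*}$. Given $u^{n},p^{n}$: Step 1: $-\triangle u^{n+1}+\nabla p^{n}=f$ in $\Omega$, $u^{n+1}|_{\partial\Omega}=0$; Step 2: $p^{n+1}-p^{n}+\beta\nabla\cdot(u^{n+1}-u^{n})+\alpha^{2}\nabla\cdot u^{n+1}=0$. For $\beta=0$ it reduces to the standard Uzawa iteration.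
   Formalization: Convergence of u^n is claimed when A^{-1} is bounded (automatic if A is bounded; false for a merely algebraic inverse), p^n converges regardless; the limit solves Au+B*p=f, with Bu=0 only when α≠0. *)

(* Defs.v *)
From HB Require Import structures.
From mathcomp Require Import all_boot all_order all_algebra sesquilinear.
From mathcomp Require Import all_classical all_reals all_analysis.

Set Implicit Arguments.
Unset Strict Implicit.
Unset Printing Implicit Defensive.

Import Order.TTheory GRing.Theory Num.Theory.
Import numFieldNormedType.Exports.

Local Open Scope classical_set_scope.
Local Open Scope ring_scope.

(* Real Hilbert spaces: complete normed spaces whose norm comes from a
   symmetric positive definite bilinear form. *)
HB.mixin Record isHilbert (R : realType) V of CompleteNormedModule R V := {
  inner : {dot V for (@idfun R)} ;
  inner_normE : forall v : V, inner v v = `|v| ^+ 2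
}.

#[short(type="hilbertType")]
HB.structure Definition Hilbert (R : realType) :=
  {V of isHilbert R V & CompleteNormedModule R V}.

Section Dual.
Context {R : realType} (V : normedModType R).

Definition dual_pred : {pred (V -> R^o)} :=
  fun phi => `[< linear phi /\ continuous phi >].

Lemma dual_predP phi : reflect (linear phi /\ continuous phi) (phi \in dual_pred).
Proof. exact: asboolP. Qed.

Fact dual_submod_closed : submod_closed dual_pred.
Proof.
split.
  apply/dual_predP; split; last exact: cst_continuous.
  by move=> a u v; rewrite /= scaler0 addr0.
move=> a f g /dual_predP[lf cf] /dual_predP[lg cg]; apply/dual_predP; split.
  move=> b u v; rewrite !fctE lf lg !scalerDr !scalerA [a * b]mulrC.
  by rewrite !addrA; congr (_ + _); rewrite -!addrA; congr (_ + _); rewrite addrC.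
by move=> x; apply: cvgD; [apply: cvgZr; exact: cf|exact: cg].
Qed.

HB.instance Definition _ :=
  GRing.isSubmodClosed.Build R (V -> R^o) dual_pred dual_submod_closed.

(* The (topological) dual space V^*; [dual_fun phi v] is the pairing <phi, v>. *)
Record dual := Dual { dual_fun :> V -> R^o ; _ : dual_fun \in dual_pred }.

HB.instance Definition _ := [isSub for dual_fun].
HB.instance Definition _ := [Choice of dual by <:].
HB.instance Definition _ := [SubChoice_isSubLmodule of dual by <:].

Definition dual_norm (phi : dual) : R :=
  sup [set `|phi v : R| | v in [set v : V | `|v| <= 1]].

End Dual.

Section Operators.
Context {R : realType}.

(* Requiring the values of Bs to lie in V^* is what makes B bounded. *)
Definition is_adjoint (V P : hilbertType R) (B : V -> P) (Bs : P -> dual V) :=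
  forall (q : P) (v : V), Bs q v = inner q (B v).

Definition schur (V P : hilbertType R) (B : V -> P)
  (Ainv : dual V -> V) (Bs : P -> dual V) : P -> P :=
  fun q => B (Ainv (Bs q)).

Definition bounded_op (P : normedModType R) (S : P -> P) :=
  exists C : R, forall q, `|S q| <= C * `|q|.

Definition self_adjoint (P : hilbertType R) (S : P -> P) :=
  forall q r : P, inner (S q) r = inner q (S r).

Definition posdef (P : hilbertType R) (S : P -> P) :=
  forall q : P, q != 0 -> 0 < inner (S q) q.

(* For T the inverse of a linear bijection A : V -> V^*, this is equivalent
   (open mapping theorem) to A being bounded; an inverse that is only algebraic
   does not make A^-1 B^* continuous, even when the Schur complement is. *)
Definition bounded_from_dual (V : normedModType R) (T : dual V -> V) :=
  exists C : R, forall phi, `|T phi| <= C * dual_norm phi.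

Definition ramshaw_mesina (V P : hilbertType R) (A : V -> dual V) (B : V -> P)
    (Bs : P -> dual V) (f : dual V) (alpha beta : R)
    (u : nat -> V) (p : nat -> P) :=
  forall n, A (u n.+1) + Bs (p n) = f /\
    p n.+1 - p n - beta *: B (u n.+1 - u n) - alpha ^+ 2 *: B (u n.+1) = 0.

End Operators.

(* Main.v *)
Require Import Defs.
From HB Require Import structures.
From mathcomp Require Import all_boot all_order all_algebra sesquilinear.
From mathcomp Require Import all_classical all_reals all_analysis.
From mathcomp Require Import lra.
Import Order.TTheory GRing.Theory Num.Theory.
Import numFieldNormedType.Exports.
Local Open Scope classical_set_scope.
Local Open Scope ring_scope.

(** Write S for the Schur complement B A^-1 B^* and g for B A^-1 f.  The first
equation of the iteration gives B u^(n+1) = g - S p^n, so eliminating the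
velocity from the second one leaves a two-term recurrence for the pressure,
  p^(n+2) = p^(n+1) - beta S (p^(n+1) - p^n) + alpha^2 (g - S p^(n+1)).

If alpha <> 0, let p be the solution of S p = g.  The error e^n = p^n - p obeys
e^(n+2) = T1 e^(n+1) + T2 e^n with T1 = 1 - (beta + alpha^2) S and
T2 = beta S.  Both are self-adjoint; T1 is nonnegative because
(beta + alpha^2) M < 1, and T1 + T2 = 1 - alpha^2 S <= rho := 1 - alpha^2 m < 1.
Instead of diagonalizing S by the spectral theorem and locating the roots of
x^2 = T1 x + T2, one finds an energy: Young's inequality for the two
semidefinite forms gives |T1 x + T2 y|^2 <= rho ((T1 x, x) + (T2 y, y))
([norm_sum_le]), whence |e^(n+1)|^2 + (T2 e^n, e^n) is multiplied by at most rho
at each step ([energy_step], [cvg0_second_order]).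

If alpha = 0 there is no such contraction towards a fixed pressure, but the
increments satisfy p^(n+2) - p^(n+1) = - beta S (p^(n+1) - p^n) and beta S has
norm at most beta M < 1 ([norm_op_le]).  The increments are thus dominated by a
geometric series and p^n converges by completeness, to a limit that depends on
p^0.

The velocity follows the pressure when A^-1 is bounded:
u^(n+1) - u = A^-1 B^* (p - p^n), and B^* is bounded by the uniform boundedness
principle ([adjoint_bounded]). *)

(** * Self-adjoint nonnegative operators *)

Section inner_algebra.
Context {R : realType} {P : hilbertType R}.
Implicit Types x y z : P.

Lemma innerC x y : inner x y = inner y x.
Proof. by rewrite hermC expr0 mul1r. Qed.

Lemma innerDl z x y : inner (x + y) z = inner x z + inner y z.
Proof. exact: (linearDl inner). Qed.

Lemma innerBl z x y : inner (x - y) z = inner x z - inner y z.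
Proof. exact: (linearBl inner). Qed.

Lemma innerZl z (a : R) x : inner (a *: x) z = a * inner x z.
Proof. exact: (linearZl_LR inner). Qed.

Lemma innerBr z x y : inner z (x - y) = inner z x - inner z y.
Proof. exact: (linearBr inner). Qed.

Lemma innerZr z (a : R) x : inner z (a *: x) = a * inner z x.
Proof. exact: (linearZr_LR inner). Qed.

Lemma inner0l x : inner 0 x = 0.
Proof. exact: (linear0l inner). Qed.

End inner_algebra.

(** Young's inequality for the semidefinite form (T x, y): expand the nonnegative
number (T (r x - z), r x - z) and divide by r. *)
Lemma two_inner_le {R : realType} {P : hilbertType R} {T : {linear P -> P}}
    {r : R} (x z : P) :
  self_adjoint T -> (forall q, 0 <= inner (T q) q) -> 0 < r ->
  2 * inner (T x) z <= r * inner (T x) x + r^-1 * inner (T z) z.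
Proof.
move=> Tsym Tge0 r_gt0.
have := Tge0 (r *: x - z).
rewrite [T _]linearB [T (_ *: _)]linearZ_LR.
rewrite !innerBl !innerBr !innerZl !innerZr (Tsym z x) (innerC z) => h.
rewrite -(ler_pM2l r_gt0) [leRHS]mulrDr mulVKf ?gt_eqF//; lra.
Qed.

(** With z = T1 x + T2 y one has |z|^2 = (T1 x, z) + (T2 y, z).  Young's
inequality with weight r bounds this by half of
r ((T1 x, x) + (T2 y, y)) + ((T1 + T2) z, z) / r, and the last term is at most
|z|^2, which is absorbed on the left. *)
Lemma norm_sum_le {R : realType} {P : hilbertType R}
    {T1 T2 : {linear P -> P}} {r : R} (x y : P) :
  self_adjoint T1 -> self_adjoint T2 ->
  (forall q, 0 <= inner (T1 q) q) -> (forall q, 0 <= inner (T2 q) q) ->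
  0 < r -> (forall q, inner (T1 q) q + inner (T2 q) q <= r * `|q| ^+ 2) ->
  `|T1 x + T2 y| ^+ 2 <= r * (inner (T1 x) x + inner (T2 y) y).
Proof.
move=> s1 s2 p1 p2 r_gt0 le_r; set z := T1 x + T2 y.
have h1 := two_inner_le x z s1 p1 r_gt0.
have h2 := two_inner_le y z s2 p2 r_gt0.
have zE : `|z| ^+ 2 = inner (T1 x) z + inner (T2 y) z.
  by rewrite -inner_normE -innerDl.
have h3 : r^-1 * (inner (T1 z) z + inner (T2 z) z) <= `|z| ^+ 2.
  by rewrite ler_pdivrMl.
lra.
Qed.

(** One step of (y, x) |-> (x, T1 x + T2 y) contracts |x|^2 + (T2 y, y): by
[norm_sum_le] the new energy is at most
r (T1 x, x) + (T2 x, x) + r (T2 y, y), and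
r (T1 x, x) + (T2 x, x) <= ((T1 + T2) x, x) <= r |x|^2 because r <= 1. *)
Lemma energy_step {R : realType} {P : hilbertType R}
    {T1 T2 : {linear P -> P}} {r : R} (x y : P) :
  self_adjoint T1 -> self_adjoint T2 ->
  (forall q, 0 <= inner (T1 q) q) -> (forall q, 0 <= inner (T2 q) q) ->
  0 < r -> r <= 1 ->
  (forall q, inner (T1 q) q + inner (T2 q) q <= r * `|q| ^+ 2) ->
  `|T1 x + T2 y| ^+ 2 + inner (T2 x) x <= r * (`|x| ^+ 2 + inner (T2 y) y).
Proof.
move=> s1 s2 p1 p2 r_gt0 r_le1 le_r.
have h := norm_sum_le x y s1 s2 p1 p2 r_gt0 le_r.
have := le_r x; have := p1 x; nra.
Qed.

(** The case T1 = 0 of [norm_sum_le] yields |T x|^2 <= r (T x, x), which avoids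
extracting the norm of a self-adjoint operator from its numerical range. *)
Lemma norm_op_le {R : realType} {P : hilbertType R} (T : {linear P -> P})
    (r : R) (x : P) :
  self_adjoint T -> (forall q, 0 <= inner (T q) q) -> 0 < r ->
  (forall q, inner (T q) q <= r * `|q| ^+ 2) -> `|T x| <= r * `|x|.
Proof.
move=> Tsym Tge0 r_gt0 le_r.
have h : `|T x| ^+ 2 <= r * inner (T x) x.
  have := @norm_sum_le _ _ \0 T r 0 x.
  rewrite /= !add0r inner0l add0r; apply => //.
  - by move=> u v; rewrite /= [RHS]innerC !inner0l.
  - by move=> q; rewrite /= inner0l.
  - by move=> q; rewrite /= inner0l add0r.
rewrite -(@ler_pXn2r _ 2) ?nnegrE ?mulr_ge0 ?(ltW r_gt0)//.
by rewrite exprMn (le_trans h)// expr2 -mulrA ler_wpM2l ?(ltW r_gt0).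
Qed.

(** * Geometric convergence *)

Lemma cvg_geometric_decay {R : realType} {P : normedModType R} (e : nat -> P)
    (E : nat -> R) (r : R) :
  0 <= r -> r < 1 -> (forall n, E n.+1 <= r * E n) ->
  (forall n, `|e n| ^+ 2 <= E n) -> e @ \oo --> (0 : P).
Proof.
move=> r_ge0 r_lt1 Er eE.
have En n : E n <= geometric (E 0%N) r n.
  elim: n => [|n IHn]; first by rewrite /= expr0 mulr1.
  by rewrite (le_trans (Er n))// /= exprS mulrCA ler_wpM2l.
have e2 : (fun n => `|e n| ^+ 2) @ \oo --> (0 : R).
  apply: (@squeeze_cvgr _ _ _ _ (cst 0) (geometric (E 0%N) r)).
  - by near=> n; rewrite sqr_ge0 (le_trans (eE n)).
  - exact: cvg_cst.
  - by apply: cvg_geometric; rewrite ger0_norm.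
apply/norm_cvg0P.
have -> : (fun n => `|e n|) = (fun n => Num.sqrt (`|e n| ^+ 2)).
  by apply/funext => n; rewrite sqrtr_sqr normr_id.
rewrite -(sqrtr0 R).
by apply: continuous_cvg; [exact: sqrt_continuous|exact: e2].
Unshelve. all: by end_near. Qed.

Lemma cvg_geometric_increments {R : realType} (P : completeNormedModType R)
    (p : nat -> P) (r : R) :
  0 <= r -> r < 1 ->
  (forall n, `|p n.+2 - p n.+1| <= r * `|p n.+1 - p n|) -> cvgn p.
Proof.
move=> r_ge0 r_lt1 pr.
have dn n : `|telescope p n| <= geometric `|p 1%N - p 0%N| r n.
  elim: n => [|n IHn]; first by rewrite /= expr0 mulr1.
  by rewrite (le_trans (pr n))// /= exprS mulrCA ler_wpM2l.
rewrite (_ : p = (cst (p 0%N) : nat -> P) + series (telescope p)); last first.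
  by apply/funext => n; rewrite [LHS]eq_sum_telescope.
apply: is_cvgD; first exact: is_cvg_cst.
apply: normed_cvg; apply: (series_le_cvg _ _ dn) => //.
  by move=> n; rewrite /= mulr_ge0 ?exprn_ge0.
by apply: is_cvg_geometric_series; rewrite ger0_norm.
Qed.

(** * The pressure recurrence *)

(** With T1 = 1 - (b + c) S and T2 = b S, the energy
|e (n + 1)|^2 + b (S (e n), e n) is contracted by [energy_step], the upper
bound on (b + c) M being what makes T1 nonnegative. *)
Lemma cvg0_second_order {R : realType} {P : hilbertType R}
    {S : {linear P -> P}} {m M b c : R} {e : nat -> P} :
  self_adjoint S ->
  (forall q, m * `|q| ^+ 2 <= inner (S q) q) ->
  (forall q, inner (S q) q <= M * `|q| ^+ 2) ->
  0 < m -> 0 < M -> 0 <= b -> 0 < c -> (b + c) * M < 1 ->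
  (forall n, e n.+2 =
     (e n.+1 - (b + c) *: S (e n.+1)) + b *: S (e n)) ->
  e @ \oo --> (0 : P).
Proof.
move=> Ssym Sge Sle m_gt0 M_gt0 b_ge0 c_gt0 bcM1 e_rec.
pose T1 : {linear P -> P} := idfun \- (b + c) \*: S.
pose T2 : {linear P -> P} := b \*: S.
have T1E q : inner (T1 q) q = `|q| ^+ 2 - (b + c) * inner (S q) q.
  by rewrite /T1 /= innerBl innerZl inner_normE.
have T2E q : inner (T2 q) q = b * inner (S q) q by rewrite /T2 /= innerZl.
have T1sym : self_adjoint T1.
  by move=> q r; rewrite /T1 /= innerBl innerBr innerZl innerZr Ssym.
have T2sym : self_adjoint T2.
  by move=> q r; rewrite /T2 /= innerZl innerZr Ssym.
have q2_ge0 (q : P) : 0 <= `|q| ^+ 2 by rewrite sqr_ge0.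
have S_ge0 q : 0 <= inner (S q) q.
  by rewrite (le_trans _ (Sge q))// mulr_ge0// ltW.
have T1_ge0 q : 0 <= inner (T1 q) q.
  rewrite T1E; have := Sle q; have := q2_ge0 q; nra.
have T2_ge0 q : 0 <= inner (T2 q) q by rewrite T2E mulr_ge0.
(* m <= M may fail on the zero space, and r > 0 below needs c k < 1. *)
pose k := Num.min m M.
have k_gt0 : 0 < k by rewrite lt_min m_gt0.
have kS q : k * `|q| ^+ 2 <= inner (S q) q.
  by rewrite (le_trans _ (Sge q))// ler_wpM2r// ge_min lexx.
have kM : k <= M by rewrite ge_min lexx orbT.
pose r := 1 - c * k.
have r_gt0 : 0 < r by rewrite /r; nra.
have r_lt1 : r < 1 by rewrite /r; nra.
have T12 q : inner (T1 q) q + inner (T2 q) q <= r * `|q| ^+ 2.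
  by rewrite T1E T2E /r; have := kS q; nra.
pose E n := `|e n.+1| ^+ 2 + inner (T2 (e n)) (e n).
rewrite -cvg_shiftS; apply: (@cvg_geometric_decay _ _ _ E r) => //.
- exact: ltW.
- move=> n; rewrite /E e_rec.
  exact: (energy_step _ _ T1sym T2sym T1_ge0 T2_ge0 r_gt0 (ltW r_lt1) T12).
- by move=> n; rewrite /E lerDl.
Qed.

(** For c != 0 the limit is the unique solution of S q = g.  For c = 0 the
right-hand side g has disappeared from the recurrence, and only the increments
can be controlled. *)
Lemma cvg_pressure {R : realType} {P : hilbertType R}
    {S : {linear P -> P}} {m M b c : R} {g ps : P} {p : nat -> P} :
  self_adjoint S ->
  (forall q, m * `|q| ^+ 2 <= inner (S q) q) ->
  (forall q, inner (S q) q <= M * `|q| ^+ 2) ->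
  0 < m -> 0 < M -> 0 <= b -> 0 <= c -> (b + c) * M < 1 ->
  S ps = g ->
  (forall n, p n.+2 =
     p n.+1 - b *: S (p n.+1 - p n) + c *: (g - S (p n.+1))) ->
  exists2 q, p @ \oo --> q & c != 0 -> S q = g.
Proof.
move=> Ssym Sge Sle m_gt0 M_gt0 b_ge0 c_ge0 bcM1 Sps p_rec.
have [c0|c_neq0] := eqVneq c 0; last first.
  exists ps => //.
  apply/(subr_cvg0 p ps).
  apply: (cvg0_second_order Ssym Sge Sle m_gt0 M_gt0 b_ge0 _ bcM1).
    by rewrite lt_def c_neq0.
  move=> n; rewrite p_rec -Sps.
  have -> : p n.+1 - p n = (p n.+1 - ps) - (p n - ps).
    by rewrite opprB addrA subrK.
  rewrite -linearB -[ps - _]opprB linearN linearB.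
  rewrite scalerBr scalerN scalerDl opprB opprD !addrA.
  by rewrite [RHS](ACl (1*5*3*4*2)).
exists (lim (p @ \oo)) => //.
have S_ge0 q : 0 <= inner (S q) q.
  by rewrite (le_trans _ (Sge q))// mulr_ge0 ?sqr_ge0// ltW.
pose T : {linear P -> P} := b \*: S.
(* Any r with b M <= r < 1 and r > 0 will do; b M itself vanishes with b. *)
pose r := (1 + b * M) / 2.
have bM1 : b * M < 1 by move: bcM1; rewrite c0 addr0.
have bM0 : 0 <= b * M by rewrite mulr_ge0// ltW.
have r_gt0 : 0 < r by rewrite /r; lra.
apply: (@cvg_geometric_increments _ _ _ r); first exact: ltW.
  by rewrite /r; lra.
move=> n.
have -> : p n.+2 - p n.+1 = - T (p n.+1 - p n).
  by rewrite p_rec c0 scale0r addr0 addrAC subrr add0r.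
rewrite normrN; apply: norm_op_le => //.
- by move=> x y; rewrite /T /= innerZl innerZr Ssym.
- by move=> q; rewrite /T /= innerZl mulr_ge0.
- move=> q; rewrite /T /= innerZl (le_trans (ler_wpM2l b_ge0 (Sle q)))//.
  by rewrite mulrA ler_wpM2r ?sqr_ge0// /r; lra.
Qed.

(** * The adjoint of B and the dual norm *)

Lemma inner_young {R : realType} {P : hilbertType R} (x y : P) :
  2 * `|inner x y| <= `|x| ^+ 2 + `|y| ^+ 2.
Proof.
have Dge0 (z : P) : 0 <= inner z z by rewrite inner_normE sqr_ge0.
have h1 := Dge0 (x - y); have h2 := Dge0 (x + y).
move: h1 h2; rewrite innerBl !innerBr innerDl !(innerC _ (x + y)) !innerDl.
rewrite (innerC y x) !inner_normE => h1 h2.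
have : `|inner x y| <= 2^-1 * (`|x| ^+ 2 + `|y| ^+ 2).
  by rewrite ler_norml; apply/andP; split; lra.
lra.
Qed.

Lemma dual_bounded {R : realType} {V : normedModType R} (phi : dual V) :
  linear phi /\ bounded_fun_norm (phi : V -> R^o).
Proof.
case: phi => phi /= phiP; have /dual_predP[lin_phi cont_phi] := phiP.
split=> //.
pose g : {linear V -> R^o} := HB.pack phi (GRing.isLinear.Build _ _ _ _ _ lin_phi).
exact/(bounded_funP g)/linear_bounded_continuous.
Qed.

Lemma dual_norm_ge0 {R : realType} {V : normedModType R} (phi : dual V) :
  0 <= dual_norm phi.
Proof.
rewrite /dual_norm; set E := [set _ | _ in _].
have [E_sup|/sup_out->//] := pselect (has_sup E).
apply: le_trans (normr_ge0 (phi 0)) _; apply: sup_upper_bound => //.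
by exists 0; rewrite //= normr0.
Qed.

Lemma adjoint_linear {R : realType} {V P : hilbertType R} {B : V -> P}
    {Bs : P -> dual V} : is_adjoint B Bs -> linear Bs.
Proof.
move=> adj a q r; apply: val_inj; apply/funext => v /=.
by rewrite [LHS]adj innerDl innerZl -!adj.
Qed.

(** The functionals Bs q with |q| <= 1 are pointwise bounded, since
|Bs q v| = |(q, B v)| is bounded in terms of |B v|; the uniform boundedness
principle on the complete space V bounds them on the unit ball, and
homogeneity in q does the rest. *)
Lemma adjoint_bounded {R : realType} {V P : hilbertType R} {B : V -> P}
    {Bs : P -> dual V} :
  is_adjoint B Bs -> exists K : R, forall q, dual_norm (Bs q) <= K * `|q|.
Proof.
move=> adj.
pose F := [set (Bs q : V -> R^o) | q in [set q : P | `|q| <= 1]].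
have F_ptw : pointwise_bounded F.
  move=> v; exists (1 + `|B v| ^+ 2) => _ [q /= q_le1 <-].
  rewrite adj; have := inner_young q (B v).
  have : `|q| ^+ 2 <= 1 by rewrite expr_le1.
  have := normr_ge0 (inner q (B v)); lra.
have [K FK] : exists K, forall f, F f -> forall v, `|v| <= 1 -> `|f v| <= K.
  apply: (Banach_Steinhauss _ F_ptw) => _ [q _ <-].
  by have [] := dual_bounded (Bs q).
exists K => q; apply: ge_sup.
  by exists `|Bs q 0|; exists 0 => //=; rewrite normr0.
move=> _ [v /= v_le1 <-]; rewrite adj.
have [->|q_neq0] := eqVneq q 0; first by rewrite inner0l !normr0 mulr0.
have q_gt0 : 0 < `|q| by rewrite normr_gt0.
have -> : q = `|q| *: (`|q|^-1 *: q).
  by rewrite scalerA divff ?gt_eqF// scale1r.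
rewrite innerZl normrM normr_id normrZ normr_id.
have q1 : `| `|q|^-1 *: q| = 1.
  by rewrite normrZ normfV normr_id mulVf// gt_eqF.
rewrite q1 mulr1 mulrC ler_wpM2r// -adj.
by apply: FK => //; exists (`|q|^-1 *: q) => //=; rewrite q1.
Qed.

(** * Convergence of the iteration *)

Theorem theorem2p1 (R : realType) (V P : hilbertType R)
    (A : {linear V -> dual V}) (B : {linear V -> P})
    (Bs : P -> dual V) (Bs_adjoint : is_adjoint B Bs)
    (f : dual V)
    (Ainv : dual V -> V) (AK : cancel A Ainv) (AinvK : cancel Ainv A)
    (S_invertible : bijective (schur B Ainv Bs))
    (S_self_adjoint : self_adjoint (schur B Ainv Bs))
    (S_bounded : bounded_op (schur B Ainv Bs))
    (S_posdef : posdef (schur B Ainv Bs))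
    (m M : R) (m_gt0 : 0 < m) (M_gt0 : 0 < M)
    (S_bounds : forall q : P, q != 0 ->
       [/\ 0 < m * `|q| ^+ 2,
           m * `|q| ^+ 2 <= inner (schur B Ainv Bs q) q
         & inner (schur B Ainv Bs q) q <= M * `|q| ^+ 2])
    (alpha beta : R) (beta_ge0 : 0 <= beta)
    (step_lt : beta + alpha ^+ 2 < 1 / M)
    (u_ : nat -> V) (p_ : nat -> P)
    (iter : ramshaw_mesina A B Bs f alpha beta u_ p_) :
  exists (u : V) (p : P),
    [/\ A u + Bs p = f,
        alpha != 0 -> B u = 0,
        p_ @ \oo --> p
      & bounded_from_dual Ainv -> u_ @ \oo --> u].
Proof.
have Ainv_lin : linear Ainv.
  by move=> a x y; apply: (can_inj AK); rewrite linearP !AinvK.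
pose Al : {linear dual V -> V} :=
  HB.pack Ainv (GRing.isLinear.Build _ _ _ _ _ Ainv_lin).
pose Bsl : {linear P -> dual V} :=
  HB.pack Bs (GRing.isLinear.Build _ _ _ _ _ (adjoint_linear Bs_adjoint)).
pose S : {linear P -> P} := B \o (Al \o Bsl).
have S_bnds q : m * `|q| ^+ 2 <= inner (S q) q <= M * `|q| ^+ 2.
  have [->|/S_bounds[_ h1 h2]] := eqVneq q 0; last by apply/andP; split.
  by rewrite [S 0]linear0 inner0l normr0 expr0n !mulr0 lexx.
have u_eq n : u_ n.+1 = Ainv (f - Bs (p_ n)).
  by have [<- _] := iter n; rewrite addrK AK.
pose g := B (Ainv f).
have B_vel q : B (Ainv (f - Bs q)) = g - S q.
  by rewrite -[Ainv _]/(Al (f - Bsl q)) !linearB.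
have Bu_eq n : B (u_ n.+1) = g - S (p_ n) by rewrite u_eq B_vel.
have p_rec n : p_ n.+2 =
    p_ n.+1 - beta *: S (p_ n.+1 - p_ n) + alpha ^+ 2 *: (g - S (p_ n.+1)).
  have Bdu : B (u_ n.+2 - u_ n.+1) = - S (p_ n.+1 - p_ n).
    rewrite [LHS]linearB !Bu_eq [S (_ - _)]linearB !opprB.
    by rewrite addrC addrA subrK.
  have [_] := iter n.+1; rewrite Bdu Bu_eq scalerN opprK.
  move=> /subr0_eq/(canRL (addrK _))/(canRL (subrK _)) ->.
  by rewrite -addrA addrC [- _ + _]addrC.
case: S_invertible => Sinv _ SinvK.
have [p p_cvg Sp] : exists2 p, p_ @ \oo --> p & alpha ^+ 2 != 0 -> S p = g.
  apply: (@cvg_pressure _ _ S _ _ _ _ _ _ _ S_self_adjoint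
    (fun q => proj1 (andP (S_bnds q))) (fun q => proj2 (andP (S_bnds q)))
    m_gt0 M_gt0 beta_ge0 (sqr_ge0 alpha) _ (SinvK g) p_rec).
  by rewrite -ltr_pdivlMr.
exists (Ainv (f - Bs p)), p; split => //.
- by rewrite AinvK subrK.
- by move=> alpha_neq0; rewrite B_vel Sp ?subrr// sqrf_eq0.
case=> C AinvC; have [K BsK] := adjoint_bounded Bs_adjoint.
rewrite -cvg_shiftS; apply/subr_cvg0/norm_cvg0P.
(* The absolute value of C is there because C may be negative when the dual
   of V is trivial. *)
apply: (@squeeze_cvgr _ _ _ _ (cst 0) (fun n => `|C| * (K * `|p - p_ n|))).
- near=> n; rewrite normr_ge0 /= u_eq.
  rewrite -[Ainv _]/(Al (f - Bsl (p_ n))) -[Ainv (f - Bs p)]/(Al (f - Bsl p)).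
  rewrite -linearB opprB addrC addrA subrK -linearB.
  rewrite (le_trans (AinvC _))//.
  rewrite (@le_trans _ _ (`|C| * dual_norm (Bs (p - p_ n))))//.
    rewrite ler_wpM2r ?ler_norm//.
    exact: dual_norm_ge0.
  by rewrite ler_wpM2l.
- exact: cvg_cst.
- rewrite -(mulr0 `|C|) -(mulr0 K); do 2 apply: cvgMl_tmp.
  apply/norm_cvg0P; rewrite -(subrr p); apply: cvgB => //; exact: cvg_cst.
Unshelve. all: by end_near. Qed.
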